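(* Let $U$ be a nonsingular $\mathcal U$-matrix with supporting dyadic tree $(T,\mathcal J)$, root $r$ and distinguished leaf $n$. Then: (i) $U^{-1}$ is a row diagonally dominant $M$-matrix if and only if $$\overline{\mu}_n\ \ge \sum_{L\in \mathrm{geod}(r,n),\,L\ne n}\frac{\overline{\mu}_{L^-}\,(1-\alpha_L\overline{\mu}_{L^+})}{1-\alpha_L\overline{\mu}_{L^-}};$$ (ii) $n\in\mathcal R$ if and only if this inequality is strict.
   Context: Trees. $(T,\mathcal J)$ is a finite tree with a distinguished root $r$; $\mathrm{geod}(s,t)$ is the unique shortest path between vertices $s,t$. Write $s\preceq t$ if $s$ lies on $\mathrm{geod}(t,r)$. $s\wedge t$ is the $\preceq$-largest vertex on both $\mathrm{geod}(s,r)$ and $\mathrm{geod}(t,r)$. Successors of $t$ are its neighbours $s\ne t$ with $t\preceq s$; leaves are vertices without successors, their set is $I$. Dyadic: every non-leaf $t$ has exactly two successors $t^-,t^+$. Each vertex $t$ is identified with the set of leaves $i$ with $t\preceq i$. $\mathcal U$-matrices. A real matrix $U=(U_{ij})_{i,j\in I}$ is a $\mathcal U$-matrix if there exist a dyadic tree with root $r$ and leaf set $I$, a distinguished leaf $n$, and nonnegative vectors $(\alpha_t)_{t\in T},(\beta_t)_{t\in T}$ with: (i) $\alpha_i=\beta_i$ for leaves $i$, and $\alpha_t=\alpha_{t\wedge n}$ for every non-leaf $t$ with $r^+\preceq t$; (ii) $\alpha_t\le\beta_t$; (iii) $t\preceq s\Rightarrow\alpha_t\le\alpha_s,\ \beta_t\le\beta_s$;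 (iv) for every non-leaf $t$ on $\mathrm{geod}(r,n)$, $t^+$ lies on $\mathrm{geod}(r,n)$, and $\alpha_t=\beta_t$ for $t$ on $\mathrm{geod}(r,n)$; (v) $U_{ii}=\alpha_i$, and for $i\ne j$, $t=i\wedge j$: $U_{ij}=\alpha_t$ if $i\in t^-,j\in t^+$; $U_{ij}=\beta_s$ if $i\in t^+,j\in t^-$, where $s$ is the $\preceq$-larger of $i\wedge j$ and $i\wedge n$. Leaves are labelled $I=\{1,\dots,n\}$ so that $i<j$ iff $i\in(i\wedge j)^-$, $j\in(i\wedge j)^+$; the distinguished leaf is the label $n$. Potentials. For a vertex $L$, $U_L=U|_{L\times L}$ (nonsingular whenever $U$ is), $\mu_L=U_L^{-1}\mathbf 1$, $\overline{\mu}_L=\mathbf 1^t\mu_L$; in particular $\overline\mu_n=1/U_{nn}$ for the leaf $\{n\}$. $\mathcal R=\{i\in I:(U^{-1}\mathbf 1)_i>0\}$ (the exiting roots of $P=E-\eta^{-1}U^{-1}$). In the sum, $L$ ranges over the non-leaf vertices on the path from $r$ to $n$. *)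

(* Defs.v *)
From mathcomp Require Import all_boot all_order all_algebra.

Set Implicit Arguments.
Unset Strict Implicit.
Unset Printing Implicit Defensive.

Import Order.TTheory GRing.Theory Num.Theory.
Local Open Scope ring_scope.

Section Graph.
Variables (T : finType) (e : rel T).

(* [s :: p] is the sequence of vertices of a path without repetition. *)
Definition simple_path (s t : T) (p : seq T) : bool :=
  [&& path e s p, uniq (s :: p) & last s p == t].

Definition is_tree : Prop :=
  [/\ symmetric e, irreflexive e
    & forall s t : T, exists! p : seq T, simple_path s t p].

(* In a tree the shortest path from [s] to [t] is the unique simple one.  The
   bound on its length makes membership decidable and loses no simple path. *)
Definition geod (s t : T) : {set T} :=
  [set u | [exists k : 'I_#|T|, exists p : k.-tuple T,
              simple_path s t p && (u \in s :: p)]].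

Variable r : T.

Definition tle (s t : T) : bool := s \in geod t r.

(* The default value [r] is never used in a tree. *)
Definition tmeet (s t : T) : T :=
  let common := geod s r :&: geod t r in
  odflt r [pick u in common | [forall v in common, tle v u]].

(* The [tle]-larger of two comparable vertices. *)
Definition tmax (s t : T) : T := if tle s t then t else s.

Definition successors (t : T) : {set T} := [set s | [&& e t s, s != t & tle t s]].

Definition leaf (t : T) : bool := successors t == set0.

End Graph.

(* [lsucc t] and [rsucc t] stand for t^- and t^+; they are unconstrained, and
   meaningless, when [t] is a leaf. *)
Record dyadic_tree (T : finType) := DyadicTree {
  edge : rel T;
  tree_root : T;
  lsucc : T -> T;
  rsucc : T -> T;
  edge_tree : is_tree edge;
  succ_neq : forall t, ~~ leaf edge tree_root t -> lsucc t != rsucc t;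
  succ_pair : forall t, ~~ leaf edge tree_root t ->
    successors edge tree_root t = [set lsucc t; rsucc t]
}.

Section DyadicTree.
Variables (T : finType) (D : dyadic_tree T).

Definition dgeod : T -> T -> {set T} := geod (edge D).
Definition dle : rel T := tle (edge D) (tree_root D).
Definition dmeet : T -> T -> T := tmeet (edge D) (tree_root D).
Definition dmax : T -> T -> T := tmax (edge D) (tree_root D).
Definition dleaf : pred T := leaf (edge D) (tree_root D).

(* The labels 1, ..., n of the leaves are shifted to 0, ..., n - 1, the elements
   of ['I_n]. *)
Definition leaf_labelling (n : nat) (lab : 'I_n -> T) : Prop :=
  [/\ injective lab,
      forall t, dleaf t <-> exists i, lab i = t
    & forall i j : 'I_n, i != j ->
        let t := dmeet (lab i) (lab j) in
        (i < j)%N <-> dle (lsucc D t) (lab i) /\ dle (rsucc D t) (lab j)].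

Definition vertex_labels (n : nat) (lab : 'I_n -> T) (L : T) : {set 'I_n} :=
  [set i | dle L (lab i)].

End DyadicTree.

(* [U] is a U-matrix with supporting tree [D], leaf labelling [lab] and
   vectors [alpha] and [beta].  There are [m.+1] leaves, and the distinguished
   leaf is the last one. *)
Record Umatrix_on (R : realFieldType) (T : finType) (D : dyadic_tree T)
    (m : nat) (lab : 'I_m.+1 -> T) (alpha beta : T -> R)
    (U : 'M[R]_m.+1) : Prop := UmatrixOn {
  um_labelling : leaf_labelling D lab;
  um_alpha_ge0 : forall t, 0 <= alpha t;
  um_beta_ge0 : forall t, 0 <= beta t;
  um_leaf : forall t, dleaf D t -> alpha t = beta t;
  um_alpha_meet : forall t, ~~ dleaf D t -> dle D (rsucc D (tree_root D)) t ->
    alpha t = alpha (dmeet D t (lab ord_max));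
  um_le : forall t, alpha t <= beta t;
  um_mono : forall t s, dle D t s -> alpha t <= alpha s /\ beta t <= beta s;
  um_geod_succ : forall t, ~~ dleaf D t ->
    t \in dgeod D (tree_root D) (lab ord_max) ->
    rsucc D t \in dgeod D (tree_root D) (lab ord_max);
  um_geod_eq : forall t, t \in dgeod D (tree_root D) (lab ord_max) ->
    alpha t = beta t;
  um_diag : forall i, U i i = alpha (lab i);
  um_upper : forall i j, i != j ->
    let t := dmeet D (lab i) (lab j) in
    dle D (lsucc D t) (lab i) -> dle D (rsucc D t) (lab j) ->
    U i j = alpha t;
  um_lower : forall i j, i != j ->
    let t := dmeet D (lab i) (lab j) in
    dle D (rsucc D t) (lab i) -> dle D (lsucc D t) (lab j) ->
    U i j = beta (dmax D t (dmeet D (lab i) (lab ord_max)))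
}.

Section Potentials.
Variables (R : realFieldType) (n : nat).
Implicit Types (U A : 'M[R]_n) (S : {set 'I_n}).

Definition principal_submx U S : 'M[R]_#|S| := mxsub enum_val enum_val U.

Definition potential U : 'cV[R]_n := invmx U *m const_mx 1.

Definition exiting_roots U : {set 'I_n} := [set i | 0 < potential U i 0].

Definition row_diag_dominant A : Prop :=
  forall i, \sum_(j | j != i) `|A i j| <= `|A i i|.

(* Nonsingular M-matrices. *)
Definition M_matrix A : Prop :=
  [/\ A \in unitmx,
      forall i j, i != j -> A i j <= 0
    & forall i j, 0 <= invmx A i j].

End Potentials.

Definition total_potential (R : realFieldType) (T : finType) (D : dyadic_tree T)
    (n : nat) (lab : 'I_n -> T) (U : 'M[R]_n) (L : T) : R :=
  \sum_i potential (principal_submx U (vertex_labels D lab L)) i 0.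

(* Main.v *)
(* Split the leaves at the root [r] as S1 = r^-, S2 = r^+ and write a for
   [alpha r].  Then U = [[A, a J], [C e_n 1^t, C]], with J the all-ones matrix:
   the lower left block repeats the last column of C.  Subtracting that column
   shows that U is nonsingular iff A - a J and C are, and it gives U^{-1} in
   terms of (A - a J)^{-1} and C^{-1}.  Since 1^t C^{-1} = e_n^t / U_nn, the
   off-diagonal entries of U^{-1} are nonpositive and its row sums other than the
   n-th are nonnegative if A - a J and C have these properties, while the n-th
   row sum is that of C^{-1} minus p (1 - a / U_nn), where
   p = 1^t (A - a J)^{-1} 1 = mubar_{r^-} / (1 - a mubar_{r^-}).  Descending along
   geod(r, n) shows that the n-th row sum of U^{-1} is the difference of the two
   sides of the inequality, and everything follows.

   The matrix A - a J is a nonsingular generalised ultrametric matrix.  The sign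
   pattern of its inverse is proved first after adding x > 0 to the diagonal,
   when all the blocks are nonsingular, and passes to the limit x -> 0 because
   the entries of the inverse are rational functions of x. *)
Require Import Defs.
From mathcomp Require Import all_boot all_order all_algebra.
From mathcomp Require Import ring lra.

Set Implicit Arguments.
Unset Strict Implicit.
Unset Printing Implicit Defensive.

Import Order.TTheory GRing.Theory Num.Theory.
Local Open Scope ring_scope.

(** * Rooted trees *)

Section RootedTree.
Variables (T : finType) (e : rel T) (r : T).
Hypothesis tree : is_tree e.

Lemma simple_path_ex s t : exists p, simple_path e s t p.
Proof. by case: tree => _ _ /(_ s t)[p [sp _]]; exists p. Qed.

Lemma simple_path_inj s t p q :
  simple_path e s t p -> simple_path e s t q -> p = q.
Proof.
by case: tree => _ _ /(_ s t)[u [_ uniq_u]] /uniq_u<- /uniq_u<-.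
Qed.

Lemma simple_path_rev s t p :
  simple_path e s t p -> exists2 q, simple_path e t s q & s :: p =i t :: q.
Proof.
case: tree => sym_e _ _ /and3P[path_p uniq_p /eqP last_p].
have eq_rev : rev (s :: p) = t :: rev (belast s p).
  by rewrite lastI rev_rcons last_p.
exists (rev (belast s p)); last by move=> u; rewrite -eq_rev mem_rev.
rewrite /simple_path -eq_rev rev_uniq uniq_p -last_p rev_path.
rewrite (eq_path (e' := e)) ?path_p => [|u v]; last by rewrite sym_e.
by case: p {path_p uniq_p last_p eq_rev} => //= u p; rewrite rev_cons last_rcons.
Qed.

(** Fixing the simple path to the root turns [tle] into membership in a list, so that the order is
    studied through suffixes of lists. *)
Definition root_path t : seq T := xchoose (simple_path_ex t r).

Lemma root_pathP t : simple_path e t r (root_path t).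
Proof. exact: xchooseP. Qed.

Lemma root_path_unique t p : simple_path e t r p -> root_path t = p.
Proof. exact: simple_path_inj (root_pathP t). Qed.

Lemma mem_geod s t p u : simple_path e s t p -> (u \in geod e s t) = (u \in s :: p).
Proof.
move=> sp; rewrite inE; apply/idP/idP.
  by case/existsP=> k /existsP[q /andP[sq]]; rewrite (simple_path_inj sp sq).
move=> us; have lt_p : (size p < #|T|)%N.
  have /and3P[_ /card_uniqP uniq_p _] := sp.
  by rewrite -[_.+1]/(size (s :: p)) -uniq_p max_card.
apply/existsP; exists (Ordinal lt_p); apply/existsP; exists (in_tuple p).
by rewrite /= sp us.
Qed.

Lemma geodC s t : geod e s t = geod e t s.
Proof.
have [p sp] := simple_path_ex s t; have [q sq pq] := simple_path_rev sp.
by apply/setP => u; rewrite (mem_geod _ sp) (mem_geod _ sq) pq.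
Qed.

Local Notation "s <=t t" := (tle e r s t) (at level 70, t at next level).

Lemma tleE s t : (s <=t t) = (s \in t :: root_path t).
Proof. exact: mem_geod (root_pathP t). Qed.

Lemma root_path_uniq t : uniq (t :: root_path t).
Proof. by have /and3P[] := root_pathP t. Qed.

(** A suffix of a simple path is simple, so by uniqueness the part after [s] is the root path of
    [s]. *)
Lemma root_path_split s t : s <=t t ->
  exists x, t :: root_path t = x ++ s :: root_path s.
Proof.
rewrite tleE; have /and3P[] := root_pathP t; move: (root_path t) => p.
rewrite inE => path_p uniq_p last_p /predU1P[->|/splitPr sp].
  by exists [::]; rewrite (@root_path_unique t p) // /simple_path path_p uniq_p.
case: sp path_p uniq_p last_p => p1 p2.
rewrite cat_path -cat_cons cat_uniq last_cat.
case/and3P=> _ _ path_p2 /and3P[_ _ uniq_p2] last_p2.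
exists (t :: p1); rewrite (@root_path_unique s p2) //.
by apply/and3P.
Qed.

Definition depth t := size (root_path t).

Lemma depth_lt t : (depth t < #|T|)%N.
Proof. 
by rewrite -[_.+1]/(size (t :: _)) -(card_uniqP (root_path_uniq t)) max_card.
Qed.

Lemma tle_refl : reflexive (tle e r).
Proof. by move=> t; rewrite tleE mem_head. Qed.

Lemma tle_trans : transitive (tle e r).
Proof.
move=> t s u st /root_path_split[x eq_u]; rewrite tleE eq_u mem_cat -tleE.
by rewrite st orbT.
Qed.

Lemma tle_depth s t : s <=t t -> (depth s <= depth t ?= iff (s == t))%N.
Proof.
move=> /root_path_split[[[-> _]|u x [-> eq_t]]]; first by split; rewrite ?eqxx.
have lt_s : (depth s < depth u)%N.
  by rewrite /depth eq_t size_cat /= addnS ltnS leq_addl.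
split; first exact: ltnW.
by rewrite ltn_eqF //; apply/esym/eqP => us; rewrite us ltnn in lt_s.
Qed.

Lemma tle_anti : antisymmetric (tle e r).
Proof.
move=> s t /andP[st ts]; apply/eqP; rewrite -(tle_depth st).
by rewrite eqn_leq (tle_depth st) (tle_depth ts).
Qed.

Lemma tle_root t : r <=t t.
Proof. by have /and3P[_ _ /eqP rt] := root_pathP t; rewrite tleE -{1}rt mem_last. Qed.

(** The root paths of [s] and [t] are both suffixes of that of [u], and of two suffixes of one list
    the shorter is contained in the longer. *)
Lemma tle_chain s t u : s <=t u -> t <=t u -> (depth s <= depth t)%N -> s <=t t.
Proof.
move=> /root_path_split[x eq_u] /root_path_split[y eq_u'] le_st.
have /(congr1 (drop (size y))) := eq_u'.
rewrite drop_size_cat // eq_u drop_cat; case: ltnP => [lt|le eq_t].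
  by move=> eq_t; rewrite tleE -eq_t mem_cat mem_head orbT.
suff /eqP xy : size x == size y.
  by rewrite xy subnn drop0 in eq_t; rewrite tleE -eq_t mem_head.
rewrite eqn_leq le /=.
have := congr1 size (etrans (esym eq_u) eq_u').
rewrite !size_cat /= -!/(depth _) !addnS => -[eq_sz].
by rewrite -(leq_add2r (depth t)) -eq_sz leq_add2l.
Qed.

Lemma successor_root_path s t : (s \in successors e r t) = (root_path s == t :: root_path t).
Proof.
case: (tree) => sym_e irr_e _; rewrite inE; apply/idP/eqP => [|eq_s]; last first.
  have /and3P[] := root_pathP s; rewrite eq_s /= => /andP[est _] /andP[s_t _] _.
  rewrite sym_e est tleE eq_s !inE eqxx orbT andbT; apply: contraNneq s_t => ->.
  exact: mem_head.
case/and3P=> ets s_t /root_path_split[x].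
case: x => [[st _]|s' x [_ eq_s]]; first by rewrite st eqxx in s_t.
have /and3P[_ uniq_s _] := root_pathP s; have /and3P[pt uniq_t lt] := root_pathP t.
apply: root_path_unique; apply/and3P; split=> //.
  by rewrite /= sym_e ets.
rewrite cons_uniq uniq_t andbT; move: uniq_s.
by rewrite eq_s cons_uniq mem_cat negb_or => /andP[/andP[]].
Qed.

Lemma tle_succ s t : t \in successors e r s -> s <=t t.
Proof. by rewrite inE => /and3P[]. Qed.

Lemma depth_succ s t : t \in successors e r s -> depth t = (depth s).+1.
Proof. by rewrite successor_root_path /depth => /eqP->. Qed.

(** Induction from the leaves down to the root, well founded because depths stay below [#|T|]. *)
Lemma tree_ind (P : T -> Prop) :
  (forall t, (forall s, s \in successors e r t -> P s) -> P t) -> forall t, P t.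
Proof.
move=> IH t; have [k] := ubnP (#|T| - depth t)%N.
elim: k t => // k IHk t; rewrite ltnS => le_k; apply: IH => s /depth_succ ds.
apply: IHk; rewrite ds; apply: leq_trans le_k.
by rewrite ltn_sub2l // ?depth_lt // -ds.
Qed.

(** The witness is the vertex that precedes [s] on the root path of [t]; as this path has no
    repetition, its two decompositions around the witness agree. *)
Lemma tle_succ_ex s t : s <=t t -> s != t ->
  exists2 u, u \in successors e r s & u <=t t.
Proof.
move=> /root_path_split[x]; case/lastP: x => [[->]|x u]; first by rewrite eqxx.
rewrite cat_rcons => eq_t _.
have ut : u <=t t by rewrite tleE eq_t mem_cat mem_head orbT.
exists u => //; have [y eq_t'] := root_path_split ut.
have uniq_t : uniq (t :: root_path t) := root_path_uniq t.
rewrite successor_root_path; apply/eqP.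
have index_x : index u (t :: root_path t) = size x.
  rewrite eq_t index_cat /= eqxx addn0 ifN //.
  by move: uniq_t; rewrite eq_t cat_uniq /= negb_or => /and3P[_ /andP[]].
have index_y : index u (t :: root_path t) = size y.
  rewrite eq_t' index_cat /= eqxx addn0 ifN //.
  by move: uniq_t; rewrite eq_t' cat_uniq /= negb_or => /and3P[_ /andP[]].
have := congr1 (drop (size x)) (etrans (esym eq_t) eq_t').
by rewrite drop_size_cat // -index_x index_y drop_size_cat // => -[].
Qed.

Lemma tle_succ_inj s u v t :
  u \in successors e r s -> v \in successors e r s -> u <=t t -> v <=t t -> u = v.
Proof.
move=> su sv ut vt; have duv : depth u = depth v by rewrite (depth_succ su) (depth_succ sv).
by apply: tle_anti; rewrite (tle_chain ut vt) ?duv // (tle_chain vt ut) ?duv.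
Qed.

Lemma leaf_max s t : leaf e r s -> s <=t t -> s = t.
Proof.
move=> /eqP leaf_s st; apply: contraTeq isT => s_t.
by have [u] := tle_succ_ex st s_t; rewrite leaf_s inE.
Qed.

Lemma tmeet_unique s t u : u <=t s -> u <=t t ->
  (forall v, v <=t s -> v <=t t -> v <=t u) -> tmeet e r s t = u.
Proof.
move=> us ut u_max; rewrite /tmeet; case: pickP => [v|/(_ u)] /=.
  rewrite -!/(tle e r _ _) inE -!/(tle e r _ _).
  case/andP=> /andP[vs vt] /forall_inP v_max; apply: tle_anti.
  by rewrite u_max // v_max // inE; apply/andP.
rewrite inE; move: us ut; rewrite /tle => -> -> /=.
by case/forall_inP => v; rewrite inE => /andP[/u_max]; apply.
Qed.

(** The predecessors of a vertex form a chain, so a common predecessor of maximal depth is the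
    largest one; the root ensures that there is one. *)
Lemma tmeetP s t : [/\ tmeet e r s t <=t s, tmeet e r s t <=t t
  & forall v, v <=t s -> v <=t t -> v <=t tmeet e r s t].
Proof.
pose P v := (v <=t s) && (v <=t t).
have Pr : P r by rewrite /P !tle_root.
case: (@arg_maxnP _ r P depth Pr) => u /andP[us ut] u_max.
have max_u v : v <=t s -> v <=t t -> v <=t u.
  move=> vs vt; apply: (tle_chain vs us); apply: u_max.
  by rewrite /P vs.
by rewrite (tmeet_unique us ut max_u).
Qed.

Lemma tmeet_succ s t u u1 u2 : u1 \in successors e r u -> u2 \in successors e r u ->
  u1 != u2 -> u1 <=t s -> u2 <=t t -> tmeet e r s t = u.
Proof.
move=> su1 su2 u12 u1s u2t; apply: tmeet_unique.
- exact: tle_trans (tle_succ su1) u1s.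
- exact: tle_trans (tle_succ su2) u2t.
move=> v vs vt; have := leqP (depth v) (depth u); case=> [le_v|].
  exact: tle_chain vs (tle_trans (tle_succ su1) u1s) le_v.
move=> lt_u; have u1v : u1 <=t v by rewrite (tle_chain u1s) ?(depth_succ su1).
have u2v : u2 <=t v by rewrite (tle_chain u2t) ?(depth_succ su2).
by rewrite (tle_succ_inj su1 su2 u1v u2v) eqxx in u12.
Qed.

End RootedTree.

(** * Inverses of principal submatrices *)

Section PolyLimit.
Variable R : realFieldType.
Implicit Types p q : {poly R}.

Lemma horner_bounded p : exists K, forall x, 0 <= x <= 1 -> `|p.[x]| <= K.
Proof.
elim/poly_ind: p => [|p c [K leK]]; first by exists 0 => x _; rewrite horner0 normr0.
exists (K + `|c|) => x x01; have /andP[x0 x1] := x01.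
rewrite hornerMXaddC (le_trans (ler_normD _ _)) // lerD2r normrM (ger0_norm x0).
by rewrite (le_trans _ (leK _ x01)) // ler_piMr.
Qed.

(** This stands in for continuity over an arbitrary ordered field: a negative constant term would
    prevail at small positive [x]. *)
Lemma horner_ge0_lim p : (forall x, 0 < x -> 0 <= p.[x]) -> 0 <= p.[0].
Proof.
elim/poly_ind: p => [|p c _] p_ge0; first by rewrite horner0.
rewrite hornerMXaddC mulr0 add0r leNgt; apply/negP => c_lt0.
(* The second bound on [x] makes the non-constant part at most [- c / 2]; the first keeps [x] where
   [K] is valid. *)
have [K leK] := horner_bounded p; pose x := Num.min 1 (- c / (2 * (`|K| + 1))).
have K1 : 0 < `|K| + 1 by rewrite ltr_wpDl.
have x_gt0 : 0 < x by rewrite lt_min ltr01 divr_gt0 ?oppr_gt0 ?mulr_gt0 ?ltr0n.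
have x_le1 : x <= 1 by rewrite ge_min lexx.
have x_le : x * (2 * (`|K| + 1)) <= - c.
  by rewrite -ler_pdivlMr ?mulr_gt0 ?ltr0n // ge_min lexx orbT.
have := p_ge0 x x_gt0; rewrite hornerMXaddC.
have px_le : p.[x] <= `|K| + 1.
  have x01 : 0 <= x <= 1 by rewrite x_le1 ltW.
  have := leK x x01; have := ler_norm p.[x]; have := ler_norm K; lra.
nra.
Qed.

End PolyLimit.

(** * Inverses of blocks, with their row and column sums *)

Section PrincipalInverse.
Variables (R : realFieldType) (n : nat).
Implicit Types (S : {set 'I_n}) (U V W : 'I_n -> 'I_n -> R) (i j k : 'I_n).

(** Only the entries indexed by [S] matter, so nested blocks share one index type and one function
    [V] may serve several of them. *)
Definition inverse_on S U V :=
  {in S &, forall i j, \sum_(k in S) U i k * V k j = (i == j)%:R}.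

Definition row_sum S V i : R := \sum_(j in S) V i j.
Definition col_sum S V j : R := \sum_(i in S) V i j.
Definition total_sum S V : R := \sum_(i in S) row_sum S V i.

Lemma total_sum_col S V : total_sum S V = \sum_(j in S) col_sum S V j.
Proof. exact: exchange_big. Qed.

(* The block matrix with diagonal blocks [U] on [S] and the identity outside
   [S]; it stands for the submatrix of [U] without changing the index type. *)
Definition pad S U : 'M[R]_n :=
  \matrix_(i, j) if (i \in S) && (j \in S) then U i j else (i == j)%:R.

Lemma eq_inverse_on S U U' V : {in S &, U =2 U'} ->
  inverse_on S U V -> inverse_on S U' V.
Proof.
move=> eqU UV i j iS jS; rewrite -(UV i j iS jS).
by apply: eq_bigr => k kS; rewrite eqU.
Qed.

Lemma mul_pad S U V i j : (pad S U *m pad S V) i j =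
  if (i \in S) && (j \in S) then \sum_(k in S) U i k * V k j else (i == j)%:R.
Proof.
rewrite mxE; have [iS|iS] := boolP (i \in S); last first.
  rewrite (bigD1 i) //= !mxE (negPf iS) eqxx mul1r big1 ?addr0 // => k k_i.
  by rewrite mxE (negPf iS) eq_sym (negPf k_i) mul0r.
rewrite (bigID (mem S)) /= [X in _ + X]big1 ?addr0 => [|k kS]; last first.
  rewrite mxE iS (negPf kS); case: eqP => [ik|]; last by rewrite mul0r.
  by rewrite -ik iS in kS.
have [jS|jS] := boolP (j \in S).
  by apply: eq_bigr => k kS; rewrite !mxE iS kS jS.
rewrite big1 => [|k kS].
  by case: eqP => // ij; rewrite -ij iS in jS.
have kj : k == j = false by apply: contraNF jS => /eqP<-.
by rewrite !mxE iS kS (negPf jS) kj mulr0.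
Qed.

Lemma inverse_on_pad S U V : inverse_on S U V <-> pad S U *m pad S V = 1%:M.
Proof.
split=> [UV|UV i j iS jS].
  apply/matrixP => i j; rewrite mul_pad mxE.
  by case: ifP => // /andP[iS jS]; rewrite UV.
by have /matrixP/(_ i j) := UV; rewrite mul_pad iS jS mxE.
Qed.

Lemma inverse_onC S U V : inverse_on S U V -> inverse_on S V U.
Proof. by rewrite !inverse_on_pad => /mulmx1C. Qed.

Lemma inverse_on_invmx S U V : inverse_on S U V ->
  pad S U \in unitmx /\ {in S &, forall i j, V i j = invmx (pad S U) i j}.
Proof.
move=> /inverse_on_pad UV; have [unitU _] := mulmx1_unit UV; split=> // i j iS jS.
by rewrite -[invmx _]mulmx1 -UV mulKmx // mxE iS jS.
Qed.

Lemma inverse_on_unique S U V W : inverse_on S U V -> inverse_on S U W ->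
  {in S &, V =2 W}.
Proof.
move=> /inverse_on_invmx[_ eqV] /inverse_on_invmx[_ eqW] i j iS jS.
by rewrite eqV ?eqW.
Qed.

Lemma inverse_on_row_sum S U V i : inverse_on S U V -> i \in S ->
  \sum_(k in S) U i k * row_sum S V k = 1.
Proof.
move=> UV iS; under eq_bigr do rewrite mulr_sumr.
rewrite exchange_big /= (bigD1 i) //= UV // eqxx big1 ?addr0 // => j /andP[jS j_i].
by rewrite UV // eq_sym (negPf j_i).
Qed.

Lemma sum_enum_val S (F : 'I_n -> R) :
  \sum_(i in S) F i = \sum_(i < #|S|) F (enum_val i).
Proof. exact: big_enum_val. Qed.

Lemma sum_potential (U : 'M[R]_n) S V : inverse_on S U V ->
  \sum_i potential (principal_submx U S) i 0 = total_sum S V.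
Proof.
move=> UV; pose W : 'M[R]_#|S| := \matrix_(i, j) V (enum_val i) (enum_val j).
have UW : principal_submx U S *m W = 1%:M.
  apply/matrixP => i j; rewrite !mxE -(inj_eq enum_val_inj) -(UV _ _ (enum_valP i) (enum_valP j)).
  by rewrite sum_enum_val; apply: eq_bigr => k _; rewrite !mxE.
have [unitU _] := mulmx1_unit UW.
rewrite /total_sum sum_enum_val; apply: eq_bigr => i _.
rewrite /potential -[invmx _]mulmx1 -UW mulKmx // mxE /row_sum sum_enum_val.
by apply: eq_bigr => j _; rewrite !mxE mulr1.
Qed.

(** Given the signs off the diagonal, the conditions on sums are row and column diagonal dominance.
    Both are kept because gluing two blocks multiplies row sums of one by column sums of the
    other. *)
Record dd_inverse S U V : Prop := DDInverse {
  dd_inverse_on : inverse_on S U V;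
  dd_off : {in S &, forall i j, i != j -> V i j <= 0};
  dd_row : {in S, forall i, 0 <= row_sum S V i};
  dd_col : {in S, forall j, 0 <= col_sum S V j}
}.

Lemma dd_total S U V : dd_inverse S U V -> 0 <= total_sum S V.
Proof. by move=> UV; apply: sumr_ge0 => i; apply: dd_row UV i. Qed.

Lemma eq_dd_inverse S U U' V : {in S &, U =2 U'} ->
  dd_inverse S U V -> dd_inverse S U' V.
Proof. by move=> eqU [UV *]; split=> //; apply: eq_inverse_on UV. Qed.

(** The shift adds a rank-one matrix, [d] times 1 1^t; the row and column sums of [V] are the
    vectors [V] 1 and 1^t [V]. *)
Lemma inverse_on_shift S U V (d : R) : inverse_on S U V -> 1 + d * total_sum S V != 0 ->
  inverse_on S (fun i j => U i j + d) (fun i j =>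
    V i j - d / (1 + d * total_sum S V) * (row_sum S V i * col_sum S V j)).
Proof.
set w := total_sum S V; move=> UV w1 i j iS jS; rewrite -(UV i j iS jS).
set e := d / _; set r := row_sum S V; set c := col_sum S V j.
have -> x y : \sum_(k in S) (U i k + d) * (V k j - x * (r k * y)) =
    \sum_(k in S) U i k * V k j + d * (\sum_(k in S) V k j)
    - x * y * (\sum_(k in S) U i k * r k) - d * x * y * (\sum_(k in S) r k).
  rewrite !mulr_sumr -big_split -!sumrB.
  by apply: eq_bigr => k _ /=; ring.
rewrite -/(col_sum S V j) -/c -/(total_sum S V) -/w.
by rewrite (inverse_on_row_sum UV iS) /e; field.
Qed.

(* Sherman-Morrison. *)
Lemma dd_inverse_shift S U V (d : R) : dd_inverse S U V -> 0 <= d ->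
  exists2 V', dd_inverse S (fun i j => U i j + d) V' &
    total_sum S V' = total_sum S V / (1 + d * total_sum S V).
Proof.
move=> UV d0; have w0 := dd_total UV; have [inv off row col] := UV.
set w := total_sum S V in w0 *; have w1 : 0 < 1 + d * w by rewrite ltr_pwDl ?mulr_ge0.
have e0 : 0 <= d / (1 + d * w) by rewrite divr_ge0 // ltW.
pose V' i j := V i j - d / (1 + d * w) * (row_sum S V i * col_sum S V j).
have inv' : inverse_on S (fun i j => U i j + d) V'.
  exact: inverse_on_shift inv (lt0r_neq0 w1).
have row' i : row_sum S V' i = row_sum S V i / (1 + d * w).
  rewrite /row_sum sumrB -!mulr_sumr -total_sum_col -/w -/(row_sum S V i).
  by field; rewrite lt0r_neq0.
have col' j : col_sum S V' j = col_sum S V j / (1 + d * w).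
  rewrite /col_sum sumrB -!mulr_sumr -mulr_suml -/(total_sum S V) -/w -/(col_sum S V j).
  by field; rewrite lt0r_neq0.
exists V'; last by rewrite /total_sum mulr_suml; apply: eq_bigr.
split=> // [i j iS jS ij|i iS|j jS].
- rewrite subr_le0; apply: le_trans (off i j iS jS ij) _.
  by rewrite mulr_ge0 // mulr_ge0 ?row ?col.
- by rewrite row' divr_ge0 ?row // ltW.
- by rewrite col' divr_ge0 ?col // ltW.
Qed.

Lemma sum_setU (S1 S2 : {set 'I_n}) (F : 'I_n -> R) : [disjoint S1 & S2] ->
  \sum_(i in S1 :|: S2) F i = \sum_(i in S1) F i + \sum_(i in S2) F i.
Proof. by move=> dis; rewrite -bigU //=; apply: eq_bigl => i; rewrite inE. Qed.

(** Block elimination puts [- g] times the outer product of the row sums of [B] and the column sums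
    of [A] in the lower left corner. The row sums on [S2] and the column sums on [S1] are thereby
    scaled by 1 minus [g] times the total of the other block, which the two bounds keep
    nonnegative. *)
Lemma dd_inverse_triangular S1 S2 U A B (g : R) : [disjoint S1 & S2] ->
    {in S1 & S2, forall i j, U i j = 0} -> {in S2 & S1, forall i j, U i j = g} ->
    dd_inverse S1 U A -> dd_inverse S2 U B ->
    0 <= g -> g * total_sum S1 A <= 1 -> g * total_sum S2 B <= 1 ->
  exists2 W, dd_inverse (S1 :|: S2) U W & total_sum (S1 :|: S2) W =
    total_sum S1 A + total_sum S2 B - g * total_sum S1 A * total_sum S2 B.
Proof.
move=> dis U12 U21 invA invB g0 gA gB.
have notS1 j : j \in S2 -> (j \in S1) = false by apply: disjointFl.
have [A_inv A_off A_row A_col] := invA; have [B_inv B_off B_row B_col] := invB.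
pose W i j := if i \in S1 then if j \in S1 then A i j else 0
  else if j \in S1 then - g * row_sum S2 B i * col_sum S1 A j else B i j.
have W11 : {in S1 &, forall i j, W i j = A i j} by move=> i j iS jS; rewrite /W iS jS.
have W12 : {in S1 & S2, forall i j, W i j = 0} by move=> i j iS /notS1 jS; rewrite /W iS jS.
have W21 : {in S2 & S1, forall i j, W i j = - g * row_sum S2 B i * col_sum S1 A j}.
  by move=> i j /notS1 iS jS; rewrite /W iS jS.
have W22 : {in S2 &, forall i j, W i j = B i j}.
  by move=> i j /notS1 iS /notS1 jS; rewrite /W iS jS.
have row1 i : i \in S1 -> row_sum (S1 :|: S2) W i = row_sum S1 A i.
  move=> iS; rewrite /row_sum sum_setU // [X in _ + X]big1 ?addr0.
    by apply: eq_bigr => j jS; rewrite W11.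
  by move=> j jS; rewrite W12.
have row2 i : i \in S2 ->
    row_sum (S1 :|: S2) W i = (1 - g * total_sum S1 A) * row_sum S2 B i.
  move=> iS; rewrite /row_sum sum_setU // (eq_bigr _ (fun j jS => W21 i j iS jS)).
  rewrite (eq_bigr (B i) (fun j jS => W22 i j iS jS)) -mulr_sumr -total_sum_col.
  by rewrite -/(row_sum S2 B i); ring.
have col1 j : j \in S1 ->
    col_sum (S1 :|: S2) W j = (1 - g * total_sum S2 B) * col_sum S1 A j.
  move=> jS; rewrite /col_sum sum_setU // (eq_bigr _ (fun i iS => W21 i j iS jS)).
  rewrite (eq_bigr (A^~ j) (fun i iS => W11 i j iS jS)) -mulr_suml -mulr_sumr.
  by rewrite -/(col_sum S1 A j) -/(total_sum S2 B); ring.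
have col2 j : j \in S2 -> col_sum (S1 :|: S2) W j = col_sum S2 B j.
  move=> jS; rewrite /col_sum sum_setU // big1 ?add0r.
    by apply: eq_bigr => i iS; rewrite W22.
  by move=> i iS; rewrite W12.
exists W; last first.
  rewrite /total_sum sum_setU // (eq_bigr _ row1) (eq_bigr _ row2) -mulr_sumr.
  by rewrite -!/(total_sum _ _); ring.
split.
- move=> i j; rewrite !inE sum_setU // => /orP[iS|iS] /orP[jS|jS].
  + rewrite -(A_inv i j iS jS) [X in _ + X]big1 ?addr0 => [|k kS]; last first.
      by rewrite U12 ?mul0r.
    by apply: eq_bigr => k kS; rewrite W11.
  + rewrite !big1 ?addr0 => [|k kS|k kS]; first 1 last.
    * by rewrite U12 ?mul0r.
    * by rewrite W12 ?mulr0.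
    by case: eqP => // ij; rewrite -ij in jS; rewrite (notS1 i) in iS.
  + rewrite (eq_bigr (fun k => g * A k j)) => [|k kS]; last by rewrite U21 ?W11.
    rewrite [X in _ + X](eq_bigr (fun k => U i k * row_sum S2 B k * (- g * col_sum S1 A j))).
      rewrite -mulr_sumr -mulr_suml (inverse_on_row_sum B_inv) // -/(col_sum _ _ _).
      case: eqP => [ij|_]; last by rewrite mul1r mulNr subrr.
      by rewrite -ij (notS1 i) in jS.
    by move=> k kS; rewrite W21 //; ring.
  + rewrite -(B_inv i j iS jS) big1 ?add0r => [|k kS]; last by rewrite W12 ?mulr0.
    by apply: eq_bigr => k kS; rewrite W22.
- move=> i j; rewrite !inE => /orP[iS|iS] /orP[jS|jS] ij.
  + by rewrite W11 ?A_off.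
  + by rewrite W12.
  + by rewrite W21 // mulNr mulNr oppr_le0 mulr_ge0 ?A_col // mulr_ge0 ?B_row.
  + by rewrite W22 ?B_off.
- move=> i; rewrite inE => /orP[iS|iS]; first by rewrite row1 ?A_row.
  by rewrite row2 // mulr_ge0 ?B_row // subr_ge0.
- move=> j; rewrite inE => /orP[jS|jS]; last by rewrite col2 ?B_col.
  by rewrite col1 // mulr_ge0 ?A_col // subr_ge0.
Qed.

(* Generalised ultrametric matrices in nested block form: [a] and [b] are the
   values of alpha and beta at the vertex whose set of leaves is [S]. *)
Inductive gum U : R -> R -> {set 'I_n} -> Prop :=
| gum_leaf i : gum U (U i i) (U i i) [set i]
| gum_node a b a1 b1 S1 a2 b2 S2 : [disjoint S1 & S2] ->
    a <= b -> a <= a1 -> a <= a2 -> b <= b1 -> b <= b2 ->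
    {in S1 & S2, forall i j, U i j = a /\ U j i = b} ->
    gum U a1 b1 S1 -> gum U a2 b2 S2 -> gum U a b (S1 :|: S2).

(* The bound on the total potential is what makes the induction work: it keeps
   the row and column sums of the next triangular block matrix nonnegative. *)
Lemma gum_dd_inverse U a b S (x c : R) : gum U a b S -> 0 < x -> c <= a ->
  exists2 V, dd_inverse S (fun i j => U i j - c + x * (i == j)%:R) V &
    (b - c) * total_sum S V <= 1.
Proof.
move=> gumU x_gt0; elim: gumU c => {a b S} [i c c_le|].
  have d_gt0 : 0 < U i i - c + x by rewrite ltr_wpDl ?subr_ge0.
  have V_gt0 : 0 < (U i i - c + x)^-1 by rewrite invr_gt0.
  exists (fun _ _ => (U i i - c + x)^-1); last first.
    rewrite /total_sum /row_sum !big_set1 ler_pdivrMr // mul1r lerDl; exact: ltW.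
  split.
  - move=> j k /set1P-> /set1P->; rewrite big_set1 eqxx mulr1.
    by rewrite mulfV // gt_eqF.
  - by move=> j k /set1P-> /set1P->; rewrite eqxx.
  - by move=> j _; rewrite /row_sum big_set1 ltW.
  - by move=> j _; rewrite /col_sum big_set1 ltW.
move=> a b a1 b1 S1 a2 b2 S2 dis ab aa1 aa2 bb1 bb2 U12 _ IH1 _ IH2 c c_le.
(* Both hypotheses are used with [a] in place of [c]: this makes the upper right block vanish, and
   [a - c] is added back by a shift at the end. *)
have [A invA gA] := IH1 a aa1; have [B invB gB] := IH2 a aa2.
have tA := dd_total invA; have tB := dd_total invB.
have neq12 i j : i \in S1 -> j \in S2 -> (i == j) = false.
  move=> iS jS; apply: contraTF dis => /eqP ij; apply/pred0Pn; exists i.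
  by rewrite /= iS ij.
have leA : (b - a) * total_sum S1 A <= 1.
  by apply: le_trans gA; rewrite ler_wpM2r // lerD2r.
have leB : (b - a) * total_sum S2 B <= 1.
  by apply: le_trans gB; rewrite ler_wpM2r // lerD2r.
have [|||W invW tW] := dd_inverse_triangular dis _ _ invA invB _ leA leB.
- by move=> i j iS jS; rewrite neq12 // mulr0 (U12 i j iS jS).1 subrr addr0.
- by move=> i j iS jS; rewrite eq_sym neq12 // mulr0 (U12 j i jS iS).2 addr0.
- by rewrite subr_ge0.
have tW0 := dd_total invW.
have [|V invV tV] := @dd_inverse_shift _ _ _ (a - c) invW; first by rewrite subr_ge0.
exists V.
  by apply: eq_dd_inverse invV => i j _ _; ring.
have den : 0 < 1 + (a - c) * total_sum (S1 :|: S2) W.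
  by rewrite ltr_pwDl // mulr_ge0 // subr_ge0.
rewrite tV mulrA ler_pdivrMr // mul1r tW.
(* With g = b - a and p, q the totals of [A] and [B], the claim is that (1 - g p) (1 - g q) is
   nonnegative, and both factors are. *)
nra.
Qed.

(* Cramer's rule, with denominator cleared by the square of the determinant. *)
Lemma inverse_on_horner S U : exists q : 'I_n -> 'I_n -> {poly R}, forall x W,
  inverse_on S (fun i j => U i j + x * (i == j)%:R) W ->
  exists2 d, 0 < d & {in S &, forall i j, (q i j).[x] = d * W i j}.
Proof.
pose N : 'M[{poly R}]_n := \matrix_(i, j)
  ((pad S U i j)%:P + ((i \in S) && (i == j))%:R *: 'X).
exists (fun i j => \det N * \adj N i j) => x W.
case/inverse_on_invmx; set P := pad S _ => unitP eqW.
have NP : map_mx (horner_eval x) N = P.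
  apply/matrixP => i j; rewrite !mxE horner_evalE hornerD hornerC hornerZ hornerX.
  have [iS|iS] := boolP (i \in S); last by rewrite mul0r addr0.
  have [jS|jS] /= := boolP (j \in S); first by rewrite mulrC.
  have -> : (i == j) = false by apply: contraNF jS => /eqP<-.
  by rewrite mul0r addr0.
have detP : \det P != 0 by rewrite -unitfE -unitmxE.
exists (\det P ^+ 2); first by rewrite exprn_even_gt0.
have detE : (\det N).[x] = \det P by rewrite -NP det_map_mx.
have adjE i j : (\adj N i j).[x] = \adj P i j by rewrite -NP -map_mx_adj [RHS]mxE.
move=> i j iS jS; rewrite eqW // /invmx unitP [fun_of_matrix (_ *: _) i j]mxE hornerM detE adjE.
by rewrite mulrA expr2 mulfK.
Qed.

(** Up to a positive factor, each entry and each sum is the value at [x] of a fixed polynomial whose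
    sign is known for [x > 0]. The given inverse at [x = 0] lets the sign be read off there too. *)
Lemma dd_inverse_lim S U V : inverse_on S U V ->
  (forall x, 0 < x -> exists W, dd_inverse S (fun i j => U i j + x * (i == j)%:R) W) ->
  dd_inverse S U V.
Proof.
move=> UV ddW; have [q qE] := inverse_on_horner S U.
have [|d d_gt0 qV] := qE 0 V.
  by apply: eq_inverse_on UV => i j _ _; rewrite mul0r addr0.
split=> // [i j iS jS ij|i iS|j jS].
- rewrite -oppr_ge0 -(pmulr_rge0 _ d_gt0) mulrN -qV // -hornerN.
  apply: horner_ge0_lim => x /[dup] x_gt0 /ddW[W invW].
  have [e e_gt0 qW] := qE x W (dd_inverse_on invW).
  by rewrite hornerN qW // oppr_ge0 pmulr_rle0 // (dd_off invW).
- rewrite -(pmulr_rge0 _ d_gt0) mulr_sumr -(eq_bigr _ (fun j jS => qV i j iS jS)).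
  rewrite -horner_sum; apply: horner_ge0_lim => x /[dup] x_gt0 /ddW[W invW].
  have [e e_gt0 qW] := qE x W (dd_inverse_on invW).
  rewrite horner_sum (eq_bigr _ (fun j jS => qW i j iS jS)) -mulr_sumr.
  by rewrite pmulr_rge0 // (dd_row invW).
- rewrite -(pmulr_rge0 _ d_gt0) mulr_sumr -(eq_bigr _ (fun i iS => qV i j iS jS)).
  rewrite -horner_sum; apply: horner_ge0_lim => x /[dup] x_gt0 /ddW[W invW].
  have [e e_gt0 qW] := qE x W (dd_inverse_on invW).
  rewrite horner_sum (eq_bigr _ (fun i iS => qW i j iS jS)) -mulr_sumr.
  by rewrite pmulr_rge0 // (dd_col invW).
Qed.

Lemma gum_dd_inverse_nonsingular U a b S (c : R) V : gum U a b S -> c <= a ->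
  inverse_on S (fun i j => U i j - c) V -> dd_inverse S (fun i j => U i j - c) V.
Proof.
move=> gumU ca UV; apply: dd_inverse_lim => // x x_gt0.
by have [W invW _] := gum_dd_inverse gumU x_gt0 ca; exists W.
Qed.

Lemma sum_delta S (F : 'I_n -> R) i : i \in S -> \sum_(k in S) F k * (k == i)%:R = F i.
Proof.
move=> iS; rewrite (bigD1 i) //= eqxx mulr1 big1 ?addr0 // => k /andP[_ /negPf->].
by rewrite mulr0.
Qed.

(** * One step along the path to the distinguished leaf *)

Section Spine.
Variables (U : 'I_n -> 'I_n -> R) (S1 S2 : {set 'I_n}) (a : R) (l : 'I_n).
Hypothesis dis : [disjoint S1 & S2].
Hypothesis lS2 : l \in S2.
Hypothesis U12 : {in S1 & S2, forall i j, U i j = a}.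
Hypothesis U21 : {in S2 & S1, forall i j, U i j = U i l}.

Let notS1 j : j \in S2 -> (j \in S1) = false.
Proof. exact: disjointFl. Qed.

(** In [V U = 1], subtracting column [l] from a column of [S1] cancels the terms from [S2] and turns
    [U] into [U - a] on [S1]. *)
Lemma spine_left_inverse V : inverse_on (S1 :|: S2) U V ->
  inverse_on S1 (fun i j => U i j - a) V.
Proof.
move=> /inverse_onC VU; apply: inverse_onC => i j iS jS.
have := VU i j; rewrite !inE iS jS => /(_ isT isT) <-.
have := VU i l; rewrite !inE iS lS2 orbT => /(_ isT isT).
have -> : (i == l) = false.
  by apply: contraTF iS => /eqP->; rewrite notS1.
rewrite !sum_setU // (eq_bigr (fun k => V i k * a)) => [|k kS]; last by rewrite U12.
move=> eq0; rewrite [X in _ = _ + X](eq_bigr (fun k => V i k * U k l)) => [|k kS].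
  move/eqP: eq0; rewrite addr_eq0 => /eqP eq0; rewrite -[X in _ + X]opprK -eq0.
  by rewrite -sumrB; apply: eq_bigr => k _; ring.
by rewrite U21.
Qed.

(** A row of [U] in [S2] is constantly [U i l] on [S1], so the rows of [V] in [S1] can be absorbed
    into row [l]. *)
Lemma spine_right_inverse V : inverse_on (S1 :|: S2) U V ->
  inverse_on S2 U (fun i j => V i j + (\sum_(k in S1) V k j) * (i == l)%:R).
Proof.
move=> UV i j iS jS; have := UV i j; rewrite !inE iS jS !orbT => /(_ isT isT) <-.
rewrite sum_setU // addrC; under eq_bigr do rewrite mulrDr mulrA.
rewrite big_split /= (sum_delta (fun k => U i k * _)) //; congr (_ + _).
by rewrite mulr_sumr; apply: eq_bigr => k kS; rewrite U21.
Qed.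

(** The row sum at [l] is left free, since its sign is what the inequality decides. The column
    condition reads 1^t [V] = e_l^t / [z]; it reflects that row [l] of the block is constantly
    [z]. *)
Record spine_inverse (S : {set 'I_n}) (z : R) V : Prop := SpineInverse {
  spine_inverse_on : inverse_on S U V;
  spine_off : {in S &, forall i j, i != j -> V i j <= 0};
  spine_col : {in S, forall j, col_sum S V j = (j == l)%:R / z};
  spine_row : {in S, forall i, i != l -> 0 <= row_sum S V i}
}.

Lemma spine_inverse_step z A C : 0 <= a -> 0 < z -> a <= z ->
    dd_inverse S1 (fun i j => U i j - a) A -> spine_inverse S2 z C ->
  exists2 V, spine_inverse (S1 :|: S2) z V &
    row_sum (S1 :|: S2) V l = row_sum S2 C l - total_sum S1 A * (1 - a / z).
Proof.
move=> a0 z0 az invA [C_inv C_off C_col C_row].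
have [A_inv A_off A_row A_col] := invA; have p0 := dd_total invA.
set p := total_sum S1 A in p0 *.
have az0 : 0 <= 1 - a / z by rewrite subr_ge0 ler_pdivrMr // mul1r.
(* Subtracting column [l] from the columns of [S1] leaves a block upper triangular matrix with
   diagonal blocks [U - a] and [U]. Undoing this in its inverse changes row [l] only, and 1^t [C] =
   e_l^t / [z] simplifies the upper right block. *)
pose V i j := if i \in S1
  then if j \in S1 then A i j else - (a / z * row_sum S1 A i) * (j == l)%:R
  else if j \in S1 then - col_sum S1 A j * (i == l)%:R
  else C i j + a * p / z * (j == l)%:R * (i == l)%:R.
have V11 : {in S1 &, forall i j, V i j = A i j} by move=> i j iS jS; rewrite /V iS jS.
have V12 : {in S1 & S2, forall i j, V i j = - (a / z * row_sum S1 A i) * (j == l)%:R}.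
  by move=> i j iS /notS1 jS; rewrite /V iS jS.
have V21 : {in S2 & S1, forall i j, V i j = - col_sum S1 A j * (i == l)%:R}.
  by move=> i j /notS1 iS jS; rewrite /V iS jS.
have V22 : {in S2 &, forall i j,
    V i j = C i j + a * p / z * (j == l)%:R * (i == l)%:R}.
  by move=> i j /notS1 iS /notS1 jS; rewrite /V iS jS.
have row1 i : i \in S1 -> row_sum (S1 :|: S2) V i = row_sum S1 A i * (1 - a / z).
  move=> iS; rewrite /row_sum sum_setU // (eq_bigr _ (fun j jS => V11 i j iS jS)).
  rewrite (eq_bigr _ (fun j jS => V12 i j iS jS)).
  by rewrite (sum_delta (fun=> - (a / z * row_sum S1 A i))) // -/(row_sum S1 A i); ring.
have row2 i : i \in S2 ->
    row_sum (S1 :|: S2) V i = row_sum S2 C i - p * (1 - a / z) * (i == l)%:R.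
  move=> iS; rewrite /row_sum sum_setU // (eq_bigr _ (fun j jS => V21 i j iS jS)).
  rewrite (eq_bigr _ (fun j jS => V22 i j iS jS)) big_split /= -!mulr_suml sumrN.
  rewrite -total_sum_col -/p (sum_delta (fun=> a * p / z)) // -/(row_sum S2 C i).
  by ring.
exists V; last by rewrite row2 // eqxx mulr1.
split.
- move=> i j; rewrite !inE sum_setU // => /orP[iS|iS] /orP[jS|jS].
  + rewrite (eq_bigr _ (fun k kS => congr1 (fun x => _ * x) (V11 k j kS jS))).
    rewrite [X in _ + X](eq_bigr (fun k => - a * col_sum S1 A j * (k == l)%:R)); last first.
      by move=> k kS; rewrite V21 // U12 //; ring.
    rewrite (sum_delta (fun=> - a * col_sum S1 A j)) // -(A_inv i j iS jS).
    by rewrite mulr_sumr -big_split; apply: eq_bigr => k kS /=; ring.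
  + rewrite (eq_bigr (fun k => (U i k - a) * row_sum S1 A k * (- a / z * (j == l)%:R)
      + row_sum S1 A k * (- a * a / z * (j == l)%:R))); last first.
      by move=> k kS; rewrite V12 //; ring.
    rewrite big_split /= -!mulr_suml (inverse_on_row_sum A_inv) // -/(total_sum S1 A) -/p.
    rewrite (eq_bigr (fun k => a * C k j + a * (a * p / z * (j == l)%:R) * (k == l)%:R));
      last by move=> k kS; rewrite V22 // U12 //; ring.
    rewrite big_split /= -mulr_sumr -/(col_sum S2 C j) C_col //.
    rewrite (sum_delta (fun=> a * (a * p / z * (j == l)%:R))) //.
    have -> : (i == j) = false by apply: contraTF iS => /eqP->; rewrite notS1.
    rewrite mulr0n; ring.
  + rewrite (eq_bigr (fun k => U i l * A k j)) => [|k kS]; last by rewrite V11 ?U21.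
    rewrite [X in _ + X](eq_bigr (fun k => U i k * (- col_sum S1 A j) * (k == l)%:R)).
      rewrite (sum_delta (fun k => U i k * (- col_sum S1 A j))) // -mulr_sumr.
      have -> : (i == j) = false by apply: contraTF jS => /eqP<-; rewrite notS1.
      by rewrite mulrN subrr.
    by move=> k kS; rewrite V21 // mulrA.
  + rewrite (eq_bigr (fun k => row_sum S1 A k * (- U i l * a / z * (j == l)%:R))).
      rewrite -mulr_suml -/(total_sum S1 A) -/p.
      rewrite (eq_bigr (fun k => U i k * C k j
        + U i k * (a * p / z * (j == l)%:R) * (k == l)%:R)); last first.
        by move=> k kS; rewrite V22 //; ring.
      rewrite big_split /= (sum_delta (fun k => U i k * (a * p / z * (j == l)%:R))) //.
      by rewrite C_inv //; ring.
    by move=> k kS; rewrite V12 // U21 //; ring.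
- move=> i j; rewrite !inE => /orP[iS|iS] /orP[jS|jS] ij.
  + by rewrite V11 ?A_off.
  + by rewrite V12 // mulNr oppr_le0 mulr_ge0 ?ler0n // mulr_ge0 ?A_row // divr_ge0 // ltW.
  + by rewrite V21 // mulNr oppr_le0 mulr_ge0 ?ler0n ?A_col.
  + rewrite V22 // -mulrA.
    (* The correction to [C] sits at the diagonal position [l], so it leaves the off-diagonal signs
       alone. *)
    have -> : (j == l)%:R * (i == l)%:R = 0 :> R.
      have [jl|_] := eqVneq j l; last by rewrite mul0r.
      by rewrite -jl (negPf ij) mulr0.
    by rewrite mulr0 addr0 C_off.
- move=> j; rewrite inE /col_sum sum_setU // => /orP[jS|jS].
  + rewrite (eq_bigr _ (fun i iS => V11 i j iS jS)).
    rewrite [X in _ + X](eq_bigr _ (fun i iS => V21 i j iS jS)).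
    rewrite (sum_delta (fun=> - col_sum S1 A j)) // subrr.
    have -> : (j == l) = false by apply: contraTF jS => /eqP->; rewrite notS1.
    by rewrite mul0r.
  + rewrite (eq_bigr (fun i => row_sum S1 A i * (- a / z * (j == l)%:R))); last first.
      by move=> i iS; rewrite V12 //; ring.
    rewrite (eq_bigr _ (fun i iS => V22 i j iS jS)) big_split /= -mulr_suml.
    rewrite (sum_delta (fun=> a * p / z * (j == l)%:R)) // -/(total_sum S1 A) -/p.
    by rewrite -/(col_sum S2 C j) C_col //; ring.
- move=> i; rewrite inE => /orP[iS|iS] il; first by rewrite row1 // mulr_ge0 ?A_row.
  by rewrite row2 // (negPf il) mulr0 subr0 C_row.
Qed.

End Spine.

End PrincipalInverse.

(** * U-matrices *)

Section LabelledTree.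
Variables (T : finType) (D : dyadic_tree T) (n : nat) (lab : 'I_n -> T).
Hypothesis lab_leaf : leaf_labelling D lab.

Local Notation labels := (vertex_labels D lab).
Let tree := edge_tree D.

Lemma lab_inj : injective lab. Proof. by case: lab_leaf. Qed.

Lemma leaf_lab i : dleaf D (lab i).
Proof. by case: lab_leaf => _ leafE _; apply/leafE; exists i. Qed.

Lemma dle_root t : dle D (tree_root D) t.
Proof. exact: (tle_root _ tree). Qed.

Lemma dle_lab i t : dle D (lab i) t = (t == lab i).
Proof.
apply/idP/eqP => [it|->]; last exact: tle_refl.
by rewrite (leaf_max tree (leaf_lab i) it).
Qed.

Lemma lsucc_successor t : ~~ dleaf D t -> lsucc D t \in successors (edge D) (tree_root D) t.
Proof. by move=> /succ_pair->; rewrite set21. Qed.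

Lemma rsucc_successor t : ~~ dleaf D t -> rsucc D t \in successors (edge D) (tree_root D) t.
Proof. by move=> /succ_pair->; rewrite set22. Qed.

Lemma dle_lsucc t : ~~ dleaf D t -> dle D t (lsucc D t).
Proof. by move/lsucc_successor; apply: tle_succ. Qed.

Lemma dle_rsucc t : ~~ dleaf D t -> dle D t (rsucc D t).
Proof. by move/rsucc_successor; apply: tle_succ. Qed.

Lemma dle_succ_split t s : ~~ dleaf D t ->
  dle D t s = [|| s == t, dle D (lsucc D t) s | dle D (rsucc D t) s].
Proof.
move=> nleaf; apply/idP/or3P => [ts|[/eqP->|ls|rs]].
- have [->|s_t] := eqVneq s t; first by constructor 1.
  rewrite eq_sym in s_t; have [u] := tle_succ_ex tree ts s_t.
  by rewrite succ_pair // => /set2P[]-> us; [constructor 2 | constructor 3].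
- exact: tle_refl.
- exact: (tle_trans tree) (dle_lsucc nleaf) ls.
- exact: (tle_trans tree) (dle_rsucc nleaf) rs.
Qed.

Lemma vertex_labels_lab i : labels (lab i) = [set i].
Proof. by apply/setP => j; rewrite !inE dle_lab (inj_eq lab_inj). Qed.

Lemma vertex_labels_succ t : ~~ dleaf D t ->
  labels t = labels (lsucc D t) :|: labels (rsucc D t).
Proof.
move=> nleaf; apply/setP => i; rewrite !inE dle_succ_split //.
by case: eqP => // it; rewrite -it leaf_lab in nleaf.
Qed.

Lemma disjoint_succ t : ~~ dleaf D t ->
  [disjoint labels (lsucc D t) & labels (rsucc D t)].
Proof.
move=> nleaf; apply/pred0P => i /=; apply: contraNF (succ_neq nleaf).
rewrite !inE => /andP[li ri]; apply/eqP.
exact: (tle_succ_inj tree (lsucc_successor nleaf) (rsucc_successor nleaf) li ri).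
Qed.

Lemma dmeet_succ t s u : ~~ dleaf D t ->
  dle D (lsucc D t) s -> dle D (rsucc D t) u -> dmeet D s u = t.
Proof.
move=> nleaf; exact: (tmeet_succ tree (lsucc_successor nleaf) (rsucc_successor nleaf) (succ_neq nleaf)).
Qed.

Lemma dmeetC s t : dmeet D s t = dmeet D t s.
Proof.
have [us ut u_max] := tmeetP (tree_root D) tree t s.
by apply: (tmeet_unique tree) => // v vs vt; apply: u_max.
Qed.

Lemma dgeod_root s t : (s \in dgeod D (tree_root D) t) = dle D s t.
Proof. by rewrite /dgeod (geodC tree). Qed.

End LabelledTree.

(** * Block structure of a U-matrix along the path to the last leaf *)

Section Umatrix.
Variables (R : realFieldType) (T : finType) (D : dyadic_tree T) (m : nat).
Variables (lab : 'I_m.+1 -> T) (alpha beta : T -> R) (U : 'M[R]_m.+1).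
Hypothesis hU : Umatrix_on D lab alpha beta U.

Local Notation labels := (vertex_labels D lab).
Local Notation vn := (lab ord_max).
Let tree := edge_tree D.
Let labP := um_labelling hU.

Lemma neq_succ t i j : ~~ dleaf D t ->
  i \in labels (lsucc D t) -> j \in labels (rsucc D t) -> i != j.
Proof.
move=> nleaf li rj; apply: contraTneq (disjoint_succ lab nleaf) => ij.
by apply/pred0Pn; exists j; rewrite /= -{1}ij li.
Qed.

Lemma Umatrix_upper t : ~~ dleaf D t ->
  {in labels (lsucc D t) & labels (rsucc D t), forall i j, U i j = alpha t}.
Proof.
move=> nleaf i j li rj; have ij := neq_succ nleaf li rj; rewrite !inE in li rj.
by have := um_upper hU ij; rewrite (dmeet_succ nleaf li rj); apply.
Qed.

Lemma Umatrix_lower t : ~~ dleaf D t ->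
  {in labels (rsucc D t) & labels (lsucc D t), forall i j,
    U i j = beta (dmax D t (dmeet D (lab i) vn))}.
Proof.
move=> nleaf i j ri lj; have ij := neq_succ nleaf lj ri; rewrite !inE in lj ri.
rewrite eq_sym in ij; have := um_lower hU ij.
by rewrite [dmeet D (lab i) (lab j)]dmeetC (dmeet_succ nleaf lj ri); apply.
Qed.

Lemma geod_rsucc t : ~~ dleaf D t -> dle D t vn -> dle D (rsucc D t) vn.
Proof. by move=> nleaf; rewrite -!dgeod_root; apply: um_geod_succ hU t nleaf. Qed.

Lemma geod_not_leaf t : dle D t vn -> t != vn -> ~~ dleaf D t.
Proof. by move=> tn; apply: contra => leaf_t; apply/eqP/(leaf_max tree leaf_t). Qed.

(** Every leaf beyond L^- meets the last leaf at [L], which precedes [t]; hence the lower entries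
    split at [t] are constantly [beta t]. *)
Lemma gum_branch L t : ~~ dleaf D L -> dle D L vn -> dle D (lsucc D L) t ->
  gum U (alpha t) (beta t) (labels t).
Proof.
move=> nleafL Ln; elim/(tree_ind tree (r := tree_root D)): t => t IH Lt.
have [leaf_t|nleaf] := boolP (dleaf D t).
  have [_ leafE _] := labP; have [i it] := (leafE t).1 leaf_t.
  by rewrite -(um_leaf hU leaf_t) -it (vertex_labels_lab labP) -(um_diag hU); constructor.
have lt := dle_lsucc nleaf; have rt := dle_rsucc nleaf.
have [al bl] := um_mono hU lt; have [ar br] := um_mono hU rt.
rewrite (vertex_labels_succ labP nleaf).
apply: (gum_node _ (um_le hU t) al ar bl br).
- exact: disjoint_succ.
- move=> i j li rj; split; first exact: (Umatrix_upper nleaf).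
  have Lj : dle D (lsucc D L) (lab j).
    by rewrite inE in rj; apply: (tle_trans tree) rj; apply: (tle_trans tree) rt.
  rewrite (Umatrix_lower nleaf rj li) (dmeet_succ nleafL Lj (geod_rsucc nleafL Ln)).
  rewrite /dmax /tmax; case: ifP => // tL; congr beta; apply: (tle_anti (r := tree_root D) tree).
  by apply/andP; split=> //; apply: (tle_trans tree) (dle_lsucc nleafL) Lt.
- by apply: IH; rewrite ?lsucc_successor //; apply: (tle_trans tree) lt.
- by apply: IH; rewrite ?rsucc_successor //; apply: (tle_trans tree) rt.
Qed.

Lemma Umatrix_last_col i : U i ord_max = alpha (dmeet D (lab i) vn).
Proof.
have [->|i_n] := eqVneq i ord_max.
  rewrite (um_diag hU) /dmeet (tmeet_unique tree (u := vn)) //; exact: tle_refl.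
have [si sn s_max] := tmeetP (tree_root D) tree (lab i) vn.
rewrite -/(dmeet D _ _) in si sn s_max *; set s := dmeet D _ _ in si sn s_max *.
have nleaf : ~~ dleaf D s.
  apply: contra i_n => leaf_s; apply/eqP/(lab_inj labP).
  by rewrite -(leaf_max tree leaf_s si) (leaf_max tree leaf_s sn).
have rn := geod_rsucc nleaf sn.
apply: (um_upper hU i_n) => //; rewrite -/s.
(* The leaf [i] lies in s^-: otherwise s^+ would be a common predecessor deeper than the meet. *)
move: (si : dle D s (lab i)); rewrite dle_succ_split // => /or3P[/eqP is_||ri] //.
  by rewrite -is_ (leaf_lab labP) in nleaf.
have := depth_succ tree (rsucc_successor nleaf).
have /(tle_depth tree)[] := s_max _ ri rn.
by move=> le_d _ eq_d; rewrite eq_d ltnn in le_d.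
Qed.

(** The meet of [i] with the last leaf lies beyond [L] on the path, so it is the vertex at which
    [beta] is taken, and there [beta] equals [alpha]. *)
Lemma Umatrix_lower_geod L : ~~ dleaf D L -> dle D L vn ->
  {in labels (rsucc D L) & labels (lsucc D L), forall i j, U i j = U i ord_max}.
Proof.
move=> nleaf Ln i j ri lj; rewrite (Umatrix_lower nleaf ri lj) Umatrix_last_col.
have [si sn s_max] := tmeetP (tree_root D) tree (lab i) vn.
have Ls : dle D L (dmeet D (lab i) vn).
  apply: s_max Ln; rewrite inE in ri; exact: (tle_trans tree) (dle_rsucc nleaf) ri.
rewrite /dmax /tmax ifT //; apply/esym/(um_geod_eq hU).
by rewrite dgeod_root.
Qed.

Lemma Umatrix_ge0 i j : 0 <= U i j.
Proof.
have [->|ij] := eqVneq i j; first by rewrite (um_diag hU) (um_alpha_ge0 hU).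
have [si sj s_max] := tmeetP (tree_root D) tree (lab i) (lab j).
rewrite -/(dmeet D _ _) in si sj s_max; set s := dmeet D _ _ in si sj s_max.
have nleaf : ~~ dleaf D s.
  apply: contra ij => leaf_s; apply/eqP/(lab_inj labP).
  by rewrite -(leaf_max tree leaf_s si) (leaf_max tree leaf_s sj).
have not_lab k : (lab k == s) = false.
  by apply: contraNF nleaf => /eqP<-; apply: leaf_lab labP k.
have not_succ u : u \in successors (edge D) (tree_root D) s ->
    dle D u (lab i) -> ~~ dle D u (lab j).
  move=> su ui; apply/negP => uj; have /(tle_depth tree)[] := s_max u ui uj.
  by rewrite (depth_succ tree su) ltnn.
have split_s k : dle D s (lab k) -> dle D (lsucc D s) (lab k) || dle D (rsucc D s) (lab k).
  by rewrite dle_succ_split // not_lab.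
move: (split_s i si) (split_s j sj) => /orP[li|ri].
  rewrite (negPf (not_succ _ (lsucc_successor nleaf) li)) /= => rj.
  by rewrite (Umatrix_upper nleaf) ?inE // (um_alpha_ge0 hU).
rewrite (negPf (not_succ _ (rsucc_successor nleaf) ri)) orbF => lj.
by rewrite (Umatrix_lower nleaf) ?inE // (um_beta_ge0 hU).
Qed.

Local Notation mubar := (total_potential D lab U).
Local Notation z := (alpha vn).

(** Invertibility passes from [L] to L^+, while the inverse with its signs is built back from the
    leaf; each vertex [L] of the path contributes one summand. *)
Lemma spine_inverse_geod L : dle D L vn -> (exists V, inverse_on (labels L) U V) ->
  0 < z /\ exists2 V, spine_inverse U ord_max (labels L) z V &
    row_sum (labels L) V ord_max = z^-1 -
      \sum_(K | [&& dle D L K, dle D K vn & K != vn])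
        mubar (lsucc D K) * (1 - alpha K * mubar (rsucc D K))
          / (1 - alpha K * mubar (lsucc D K)).
Proof.
elim/(tree_ind tree (r := tree_root D)): L => L IH Ln [V0 UV0].
have [Lvn|L_vn] := eqVneq L vn.
  rewrite {}Lvn (vertex_labels_lab labP) {L IH Ln} in UV0 *.
  have z_neq0 : z != 0.
    have := UV0 ord_max ord_max; rewrite !inE big_set1 eqxx (um_diag hU).
    by move=> /(_ isT isT) zV; apply: contra_eq_neq zV => ->; rewrite mul0r eq_sym oner_eq0.
  have z_gt0 : 0 < z by rewrite lt0r z_neq0 (um_alpha_ge0 hU).
  split=> //; exists (fun _ _ => z^-1).
    split.
    - by move=> i j /set1P-> /set1P->; rewrite big_set1 eqxx (um_diag hU) mulfV.
    - by move=> i j /set1P-> /set1P->; rewrite eqxx.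
    - by move=> j /set1P->; rewrite /col_sum big_set1 eqxx mul1r.
    - by move=> i /set1P->; rewrite eqxx.
  rewrite /row_sum big_set1 big_pred0 ?subr0 // => K.
  by rewrite (dle_lab labP); case: eqP => //=; rewrite andbF.
have nleaf := geod_not_leaf Ln L_vn; have rn := geod_rsucc nleaf Ln.
have dis := disjoint_succ lab nleaf.
have U12 := Umatrix_upper nleaf; have U21 := Umatrix_lower_geod nleaf Ln.
have n_in : ord_max \in labels (rsucc D L) by rewrite inE.
rewrite (vertex_labels_succ labP nleaf) in UV0 *.
have [aL _] := um_mono hU (dle_lsucc nleaf).
have gumL := gum_branch nleaf Ln (tle_refl (tree_root D) tree (lsucc D L)).
have := spine_left_inverse dis n_in U12 U21 UV0.
move=> /(gum_dd_inverse_nonsingular gumL aL).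
move: (V0 : 'I_m.+1 -> 'I_m.+1 -> R) UV0 => A UV0 invA.
have [|z_gt0 [C invC rowC]] := IH (rsucc D L) (rsucc_successor nleaf) rn.
  by eexists; apply: (spine_right_inverse dis n_in U21 UV0).
split=> //; have a0 := um_alpha_ge0 hU L; have [az _] := um_mono hU Ln.
have [V invV rowV] := spine_inverse_step dis n_in U12 U21 a0 z_gt0 az invA invC.
exists V => //; rewrite rowV rowC -addrA -opprD; congr (_ - _).
rewrite [RHS](bigD1 L) /=; last by rewrite Ln L_vn !andbT; apply: tle_refl.
rewrite [LHS]addrC; congr (_ + _).
  have [A' invA' tA'] := dd_inverse_shift invA a0.
  have p0 := dd_total invA; set p := total_sum _ A in p0 tA' *.
  have mul : mubar (lsucc D L) = p / (1 + alpha L * p).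
    rewrite -tA'; apply: sum_potential; apply: eq_inverse_on (dd_inverse_on invA').
    by move=> i j _ _; rewrite subrK.
  (* The column sums of [C] vanish except at the last leaf, where the value is [z^-1]. *)
  have mur : mubar (rsucc D L) = z^-1.
    rewrite /total_potential (sum_potential (spine_inverse_on invC)) total_sum_col.
    rewrite (eq_bigr (fun j => z^-1 * (j == ord_max)%:R)).
      by rewrite (sum_delta (fun=> z^-1)).
    by move=> j jS; rewrite (spine_col invC) // mulrC.
  have d0 : 1 + alpha L * p != 0 by rewrite gt_eqF // ltr_pwDl // mulr_ge0.
  rewrite mul mur; have -> : 1 - alpha L * (p / (1 + alpha L * p)) = (1 + alpha L * p)^-1.
    by field.
  by field; rewrite d0 gt_eqF.
(* Predecessors of the last leaf form a chain, so those strictly beyond [L] are exactly those from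
   L^+ on. *)
apply: eq_bigl => K; have [Kn|] := boolP (dle D K vn); last by rewrite !andbF.
have [//|K_vn] := eqVneq K vn; rewrite ?andbF // !andbT.
have dr := depth_succ tree (rsucc_successor nleaf).
apply/idP/andP => [rK|[LK KL]].
  split; first exact: (tle_trans tree) (dle_rsucc nleaf) rK.
  apply: contraTneq rK => ->; apply/negP => /(tle_depth tree)[].
  by rewrite dr ltnn.
apply: (tle_chain (tree := tree) rn Kn); rewrite dr.
by rewrite ltn_neqAle !(tle_depth tree LK) eq_sym KL.
Qed.

End Umatrix.

(** * Row dominance read off the row sums *)

Section RowDominance.
Variables (R : realFieldType) (n : nat) (A : 'M[R]_n).
Hypothesis A_unit : A \in unitmx.
Hypothesis A_off : forall i j, i != j -> A i j <= 0.
Hypothesis A_inv_ge0 : forall i j, 0 <= invmx A i j.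

(** In the diagonal entry of [A] times its inverse, the off-diagonal terms are nonpositive and the
    sum is 1, so the diagonal term must be positive. *)
Lemma Zmatrix_diag_gt0 i : 0 < A i i.
Proof.
have /matrixP/(_ i i) := mulmxV A_unit; rewrite !mxE eqxx (bigD1 i) //=.
have le0 : \sum_(j | j != i) A i j * invmx A j i <= 0.
  by apply: sumr_le0 => j ji; rewrite mulr_le0_ge0 // A_off // eq_sym.
have := A_inv_ge0 i i; move: (\sum_(j | _) _) le0 => s s0 inv0 /esym eq1.
rewrite ltNge; apply/negP => le_A; have := mulr_le0_ge0 le_A inv0; lra.
Qed.

Lemma row_diag_dominantP :
  row_diag_dominant A <-> forall i, 0 <= \sum_j A i j.
Proof.
have sumE i : \sum_j A i j = `|A i i| - \sum_(j | j != i) `|A i j|.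
  rewrite (bigD1 i) //= gtr0_norm ?Zmatrix_diag_gt0 // -sumrN; congr (_ + _).
  by apply: eq_bigr => j ji; rewrite ler0_norm ?opprK // A_off // eq_sym.
by split=> dom i; have := dom i; rewrite sumE subr_ge0.
Qed.

End RowDominance.
Theorem theorem3p3 (R : realFieldType) (T : finType) (D : dyadic_tree T)
    (m : nat) (lab : 'I_m.+1 -> T) (alpha beta : T -> R) (U : 'M[R]_m.+1)
    (hU : Umatrix_on D lab alpha beta U) (nonsingU : U \in unitmx) :
  let vn := lab ord_max in
  let mubar := total_potential D lab U in
  let bound :=
    \sum_(L in dgeod D (tree_root D) vn | L != vn)
      mubar (lsucc D L) * (1 - alpha L * mubar (rsucc D L))
        / (1 - alpha L * mubar (lsucc D L)) in
  (row_diag_dominant (invmx U) /\ M_matrix (invmx U) <-> bound <= mubar vn)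
  /\ (ord_max \in exiting_roots U <-> bound < mubar vn).
Proof.
move=> vn mubar bound; have labP := um_labelling hU.
have labels_root : vertex_labels D lab (tree_root D) = [set: 'I_m.+1].
  by apply/setP => i; rewrite !inE dle_root.
have UV : inverse_on (vertex_labels D lab (tree_root D)) U (invmx U).
  move=> i j _ _; have /matrixP/(_ i j) := mulmxV nonsingU; rewrite !mxE => <-.
  by rewrite labels_root; apply: eq_bigl => k; rewrite inE.
have [|z_gt0 [V invV rowV]] := spine_inverse_geod hU (dle_root D vn).
  by eexists; exact: UV.
have VE i j : V i j = invmx U i j.
  by apply: (inverse_on_unique (spine_inverse_on invV) UV); rewrite labels_root inE.
have row_sumE i : \sum_j invmx U i j = row_sum (vertex_labels D lab (tree_root D)) V i.
  by rewrite /row_sum labels_root; apply: eq_big => [j|j _]; rewrite ?inE ?VE.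
(* This row sum is the potential at the last leaf and the only row sum whose sign is not automatic,
   so the identity settles both claims. *)
have sum_n : \sum_j invmx U ord_max j = mubar vn - bound.
  rewrite row_sumE rowV; congr (_ - _).
    rewrite /mubar /total_potential (sum_potential (V := fun _ _ => (alpha vn)^-1)).
      by rewrite /total_sum /row_sum (vertex_labels_lab labP) !big_set1.
    rewrite (vertex_labels_lab labP) => i j /set1P-> /set1P->.
    by rewrite big_set1 eqxx (um_diag hU) mulfV // gt_eqF.
  by apply: eq_bigl => K; rewrite dgeod_root dle_root.
split; last first.
  rewrite inE /potential mxE -[bound < _]subr_gt0 -sum_n.
  by rewrite (eq_bigr (fun j => invmx U ord_max j)) // => j _; rewrite mxE mulr1.
(* This holds whether or not the inequality does; only dominance of the last row remains to be
   decided. *)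
have M_invU : M_matrix (invmx U).
  split; [by rewrite unitmx_inv | move=> i j ij | move=> i j].
    by rewrite -VE (spine_off invV) // labels_root inE.
  by rewrite invmxK (Umatrix_ge0 hU).
have [unitV off inv_ge0] := M_invU.
rewrite row_diag_dominantP // -[bound <= _]subr_ge0 -sum_n.
split=> [[]//|n_ge0]; split=> // i.
have [->//|i_n] := eqVneq i ord_max.
by rewrite row_sumE (spine_row invV) // labels_root inE.
Qed.
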